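(* Let $\phi$ be a partial MAX-SAT instance on $n$ variables with only hard clauses $C^{\mathbf H}_1,\dots,C^{\mathbf H}_q$ (no soft clauses), and let $\mathbf x$ be a monomial basis such that $1\in\mathbf x$ and $\mathbf x^\gamma\ne\emptyset$ for every $\gamma$ contained in some $C_p^{\mathbf H}$. Consider the sum-of-squares programme $\min\{\langle I,M\rangle+\sum_{p=1}^q c_p : (M,c)\in\mathcal M^{\mathbf H}_\phi,\ M\succeq 0\}$ and its Lagrangian dual $$\max_{S\in\mathcal X_\phi,\ S\succeq 0}\ \ \inf_{(M,c)\in\mathcal M^{\mathbf H}_\phi}\ \langle I-S,M\rangle+\mathbf 1^\top c .$$ For $S\in\mathcal X_\phi$ with $S\succeq 0$, the inner infimum is bounded from below if and only if $v^{\mathrm{SDP}}(S,C_p^{\mathbf H})=1$ for all $p\in[q]$, and in that case it equals $0$. Hence the dual programme is equivalent to the semidefinite feasibility problem $$\max\ 0\quad\text{s.t. } S\in\mathcal X_\phi,\ S\succeq 0,\ v^{\mathrm{SDP}}(S,C_p^{\mathbf H})=1\ \text{ for all } p\in[q].$$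
   Context: Notation: $[n]=\{1,\dots,n\}$; $\triangle$ is symmetric difference; $\langle X,Y\rangle=\operatorname{Tr}(XY)$; $x^\alpha=\prod_{i\in\alpha}x_i$ for $\alpha\subseteq[n]$. Each hard clause is $C^{\mathbf H}_p=\bigvee_{i\in I_p^+}x_i\vee\bigvee_{i\in I_p^-}\neg x_i$ with $I_p^+\cap I_p^-=\emptyset$; $C_p^{\mathbf H}$ also denotes the set $I_p^+\cup I_p^-$, with $\ell_p=|C_p^{\mathbf H}|$; $a_{p,i}=1$ if $i\in I_p^+$, $-1$ if $i\in I_p^-$, $0$ otherwise; $a_p^\gamma=\prod_{i\in\gamma}a_{p,i}$. A monomial basis $\mathbf x$ is a list of distinct monomials $x^\alpha$, $\alpha\subseteq[n]$; $\mathbf x^\gamma=\{(\alpha,\beta): x^\alpha,x^\beta\in\mathbf x,\ \alpha\triangle\beta=\gamma\}$ (ordered pairs). Matrices are real symmetric, indexed by $\{\alpha:x^\alpha\in\mathbf x\}$. For $\gamma\subseteq[n]$ let $\mathbf H^\gamma=\{p\in[q]:\gamma\subseteq C_p^{\mathbf H}\}$. With no soft clauses, $$\mathcal M^{\mathbf H}_\phi=\Big\{(M,c)\in\mathcal S\times\mathbb R^q:\ \sum_{(\alpha,\beta)\in\mathbf x^\gamma}M_{\alpha,\beta}+\sum_{p\in\mathbf H^\gamma}(-1)^{|\gamma\cap I_p^+|}c_p=0\ \text{ for all }\gamma\ne\emptyset\text{ with }\mathbf x^\gamma\neq\emptyset\Big\},$$ $$\mathcal X_\phi=\{S\in\mathcal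 S:\ \operatorname{diag}(S)=\mathbf 1,\ S_{\alpha,\beta}=S_{\alpha',\beta'}\text{ whenever }\alpha\triangle\beta=\alpha'\triangle\beta'\}.$$ For $S\in\mathcal X_\phi$, $v^{\mathrm{SDP}}(S,C_p^{\mathbf H})=1-2^{-\ell_p}\sum_{\gamma\subseteq C_p^{\mathbf H}}(-1)^{|\gamma|}a_p^\gamma\,S(\gamma)$, where $S(\gamma)=S_{\alpha,\beta}$ for any $(\alpha,\beta)\in\mathbf x^\gamma$ (in particular $S(\emptyset)=1$). *)

(* Defs.v *)
From HB Require Import structures.
From mathcomp Require Import all_boot all_order all_algebra.
From mathcomp Require Import all_classical all_reals all_analysis.

Set Implicit Arguments.
Unset Strict Implicit.
Unset Printing Implicit Defensive.

Import Order.TTheory GRing.Theory Num.Theory.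

Local Open Scope ring_scope.

(* The variable x_i is identified with i : 'I_n, and the
   monomial x^alpha with the set alpha : {set 'I_n}.  A partial MAX-SAT instance
   with q clauses, all of them hard, is a family phi : 'I_q -> clause n (repeated
   and empty clauses are allowed).  A monomial basis is a duplicate-free tuple
   x : m.-tuple {set 'I_n}; matrices indexed by the basis are 'M_m, the index
   i : 'I_m standing for the monomial tnth x i. *)

Definition inner_prod (R : realType) (m : nat) (X Y : 'M[R]_m) : R :=
  \tr (X *m Y).

Definition psd (R : realType) (m : nat) (X : 'M[R]_m) : Prop :=
  X \is symmetricmx /\ forall u : 'rV[R]_m, 0 <= (u *m X *m u^T) 0 0.

(* Maximisation programmes.  The objective may take the value -oo (as a Lagrangian
   dual function does), so a feasible point counts as a solution only if its
   objective is not -oo; the supremum over an empty feasible set is -oo. *)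
Record max_prog (R : realType) (T : Type) := MaxProg {
  max_dom : set T;
  max_obj : T -> \bar R }.

Definition max_value (R : realType) (T : Type) (P : max_prog R T) : \bar R :=
  ereal_sup [set max_obj P s | s in max_dom P]%classic.

Definition effective_dom (R : realType) (T : Type) (P : max_prog R T) : set T :=
  [set s | max_dom P s /\ (-oo < max_obj P s)%E]%classic.

Definition max_solutions (R : realType) (T : Type) (P : max_prog R T) : set T :=
  [set s | effective_dom P s /\ max_obj P s = max_value P]%classic.

Definition max_equiv (R : realType) (T : Type) (P Q : max_prog R T) : Prop :=
  [/\ effective_dom P = effective_dom Q,
      forall s, effective_dom P s -> max_obj P s = max_obj Q s,
      max_value P = max_value Q &
      max_solutions P = max_solutions Q].

(* The programme  min {f(t) : t in D, F(t) psd}  and its Lagrangian dual, in which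
   only the semidefinite constraint is dualised, with a multiplier S psd. *)
Record psd_min_prog (R : realType) (T : Type) (m : nat) := PsdMinProg {
  psd_dom : set T;
  psd_obj : T -> R;
  psd_map : T -> 'M[R]_m }.

Definition lagrangian (R : realType) (T : Type) (m : nat)
    (P : psd_min_prog R T m) (t : T) (S : 'M[R]_m) : R :=
  psd_obj P t - inner_prod S (psd_map P t).

Definition lagrangian_dual (R : realType) (T : Type) (m : nat)
    (P : psd_min_prog R T m) : max_prog R 'M[R]_m :=
  MaxProg [set S | psd S]%classic
    (fun S => ereal_inf [set (lagrangian P t S)%:E | t in psd_dom P]%classic).

Record clause (n : nat) := Clause {
  pos_vars : {set 'I_n};
  neg_vars : {set 'I_n};
  _ : [disjoint pos_vars & neg_vars] }.

Definition vars (n : nat) (C : clause n) : {set 'I_n} :=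
  pos_vars C :|: neg_vars C.

Definition lit_sign (R : realType) (n : nat) (C : clause n) (i : 'I_n) : R :=
  if i \in pos_vars C then 1 else if i \in neg_vars C then -1 else 0.

Definition symdiff (n : nat) (A B : {set 'I_n}) : {set 'I_n} :=
  (A :\: B) :|: (B :\: A).

(* The set x^gamma of ordered pairs. *)
Definition basis_pairs (n m : nat) (x : m.-tuple {set 'I_n})
    (g : {set 'I_n}) : {set 'I_m * 'I_m} :=
  finset (fun ij => symdiff (tnth x ij.1) (tnth x ij.2) == g).

Section Programmes.
Variables (R : realType) (n m q : nat).
Variables (phi : 'I_q -> clause n) (x : m.-tuple {set 'I_n}).

(* M_phi^H; the inner sum over p ranges over H^gamma. *)
Definition M_set : set ('M[R]_m * 'cV[R]_q) :=
  [set Mc : 'M[R]_m * 'cV[R]_q | Mc.1 \is symmetricmx /\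
    forall g : {set 'I_n}, g != finset.set0 ->
      basis_pairs x g != finset.set0 ->
      \sum_(ij in basis_pairs x g) Mc.1 ij.1 ij.2 +
      \sum_(p < q | g \subset vars (phi p))
         (-1) ^+ #|g :&: pos_vars (phi p)| * Mc.2 p 0 = 0]%classic.

(* X_phi *)
Definition X_set : set 'M[R]_m :=
  [set S | [/\ S \is symmetricmx,
    forall i, S i i = 1 &
    forall i j i' j',
      symdiff (tnth x i) (tnth x j) = symdiff (tnth x i') (tnth x j') ->
      S i j = S i' j']]%classic.

(* S(gamma).  The choice of the pair is immaterial on X_phi (moment_eq); the
   value 0 when x^gamma is empty is a junk value. *)
Definition moment (S : 'M[R]_m) (g : {set 'I_n}) : R :=
  if [pick ij in basis_pairs x g] is Some ij then S ij.1 ij.2 else 0.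

Lemma moment_eq S g i j :
  X_set S -> (i, j) \in basis_pairs x g -> moment S g = S i j.
Proof.
move=> [_ _ XS]; rewrite /moment inE /= => /eqP ijg.
case: pickP => [[i' j'] | /(_ (i, j))]; rewrite inE /= ?ijg ?eqxx // => /eqP ijg'.
by apply: XS; rewrite ijg' ijg.
Qed.

Definition v_sdp (S : 'M[R]_m) (C : clause n) : R :=
  1 - 2 ^- #|vars C| *
    \sum_(g : {set 'I_n} | g \subset vars C)
      (-1) ^+ #|g| * (\prod_(i in g) lit_sign R C i) * moment S g.

Definition sos_prog : psd_min_prog R ('M[R]_m * 'cV[R]_q) m :=
  PsdMinProg M_set
    (fun Mc : 'M[R]_m * 'cV[R]_q => inner_prod 1%:M Mc.1 + \sum_(p < q) Mc.2 p 0)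
    (fun Mc : 'M[R]_m * 'cV[R]_q => Mc.1).

Definition inner_inf (S : 'M[R]_m) : \bar R :=
  ereal_inf [set (inner_prod (1%:M - S) Mc.1 + \sum_(p < q) Mc.2 p 0)%:E
            | Mc in M_set]%classic.

Definition dual_prog : max_prog R 'M[R]_m :=
  MaxProg [set S | X_set S /\ psd S]%classic inner_inf.

Definition feasibility_prog : max_prog R 'M[R]_m :=
  MaxProg [set S | [/\ X_set S, psd S & forall p, v_sdp S (phi p) = 1]]%classic
    (fun=> 0%E).

End Programmes.

(* Main.v *)
Require Import Defs.
From HB Require Import structures.
From mathcomp Require Import all_boot all_order all_algebra.
From mathcomp Require Import all_classical all_reals all_analysis.
From mathcomp Require Import lra.

Set Implicit Arguments.
Unset Strict Implicit.
Unset Printing Implicit Defensive.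

Import Order.TTheory GRing.Theory Num.Theory.

Local Open Scope ring_scope.

(* The inner objective is linear on the linear space M_phi^H, so it is bounded from
   below iff it vanishes identically.  Testing it on M = E_ii and on
   M = E_ij + E_ji - E_i'j' - E_j'i' with c = 0 forces S in X_phi.  For S in X_phi,
   grouping the entries of M by gamma and eliminating them with the constraints
   leaves sum_p 2^(l_p) (1 - v_p(S)) c_p, in which c is arbitrary. *)

(** * Symmetric matrices, the trace inner product and symmetric differences *)

Lemma symmetricmxP (R : realType) (m : nat) (A : 'M[R]_m) :
  reflect (A = A^T) (A \is symmetricmx).
Proof.
have -> : A^T = (-1) ^+ false *: map_mx idfun A^T.
  by rewrite expr0 scale1r map_mx_id.
exact: is_hermitianmxP.
Qed.

Lemma symmetricmx_entry (R : realType) (m : nat) (A : 'M[R]_m) i j :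
  A \is symmetricmx -> A i j = A j i.
Proof. by move/symmetricmxP => {1}->; rewrite mxE. Qed.

(** Symmetry of [Y] undoes the index swap in the trace of [X *m Y]. *)
Lemma inner_prodE (R : realType) (m : nat) (X Y : 'M[R]_m) :
  Y \is symmetricmx ->
  inner_prod X Y = \sum_ij X ij.1 ij.2 * Y ij.1 ij.2.
Proof.
move=> symY; rewrite /inner_prod /mxtrace.
rewrite -(pair_bigA _ (fun i j => X i j * Y i j)).
apply: eq_bigr => i _; rewrite mxE; apply: eq_bigr => j _.
by rewrite (symmetricmx_entry _ _ symY).
Qed.

Lemma inner_prod_delta (R : realType) (m : nat) (X : 'M[R]_m) a b :
  inner_prod X (delta_mx a b) = X b a.
Proof.
rewrite /inner_prod /mxtrace (bigD1 b) //= big1 ?addr0 => [|i /negPf nib].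
  rewrite mxE (bigD1 a) //= big1 => [|j /negPf nja]; rewrite mxE ?nja ?mulr0 //.
  by rewrite !eqxx mulr1 addr0.
by rewrite mxE big1 // => j _; rewrite mxE nib andbF mulr0.
Qed.

Lemma inner_prodDr (R : realType) (m : nat) (X A B : 'M[R]_m) :
  inner_prod X (A + B) = inner_prod X A + inner_prod X B.
Proof. by rewrite /inner_prod mulmxDr mxtraceD. Qed.

Lemma inner_prodBr (R : realType) (m : nat) (X A B : 'M[R]_m) :
  inner_prod X (A - B) = inner_prod X A - inner_prod X B.
Proof. by rewrite /inner_prod mulmxBr raddfB. Qed.

Lemma symdiffC (n : nat) (A B : {set 'I_n}) : symdiff A B = symdiff B A.
Proof. exact: finset.setUC. Qed.

Lemma symdiffvv (n : nat) (A : {set 'I_n}) : symdiff A A = finset.set0.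
Proof. by rewrite /symdiff finset.setDv finset.setU0. Qed.

Lemma symdiff_eq0 (n : nat) (A B : {set 'I_n}) :
  (symdiff A B == finset.set0) = (A == B).
Proof. by rewrite finset.setU_eq0 !finset.setD_eq0 finset.eqEsubset. Qed.

(** * Equivalence of maximisation programmes *)

Section MaxEquiv.
Variables (R : realType) (T : Type).
Implicit Types P Q : max_prog R T.

(** Points of value -oo never raise a supremum, so they may be dropped. *)
Lemma max_value_effective P :
  max_value P = ereal_sup [set max_obj P s | s in effective_dom P]%classic.
Proof.
apply/eqP; rewrite eq_le; apply/andP; split.
  apply: ge_ereal_sup => _ [s Ps <-].
  have [lt|] := ltP -oo%E (max_obj P s); last first.
    by rewrite leeNy_eq => /eqP ->; rewrite leNye.
  by apply: ereal_sup_ubound; exists s.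
by apply: ereal_sup_le => _ [s [Ps _] <-]; exists s.
Qed.

(** Value and solutions depend only on the objective over the effective domain. *)
Lemma max_equiv_effective P Q :
  effective_dom P = effective_dom Q ->
  (forall s, effective_dom P s -> max_obj P s = max_obj Q s) ->
  max_equiv P Q.
Proof.
move=> eqD eqO.
have eqV : max_value P = max_value Q.
  rewrite !max_value_effective -eqD; congr ereal_sup.
  by apply/seteqP; split=> _ [s Ps <-]; exists s => //; rewrite eqO.
split=> //; apply/seteqP; split=> s [Ps optP].
  by split; rewrite -?eqD -?eqO -?eqV.
by move: Ps; rewrite -eqD => Ps; split; rewrite // eqO // eqV.
Qed.

End MaxEquiv.

(** * The linear space [M_set] and the inner infimum *)

Section Programmes.
Variables (R : realType) (n m q : nat).
Variables (phi : 'I_q -> clause n) (x : m.-tuple {set 'I_n}).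
Implicit Types (S : 'M[R]_m) (Mc : 'M[R]_m * 'cV[R]_q) (g : {set 'I_n}).

Definition inner_obj S Mc : R :=
  inner_prod (1%:M - S) Mc.1 + \sum_(p < q) Mc.2 p 0.

Lemma lagrangianE S Mc : lagrangian (sos_prog R phi x) Mc S = inner_obj S Mc.
Proof.
by rewrite /lagrangian /inner_obj /inner_prod /= mulmxBl raddfB addrAC.
Qed.

Lemma inner_objZ S t Mc : inner_obj S (t *: Mc.1, t *: Mc.2) = t * inner_obj S Mc.
Proof.
rewrite /inner_obj /inner_prod /= -scalemxAr mxtraceZ mulrDr.
by congr (_ + _); rewrite mulr_sumr; apply: eq_bigr => p _; rewrite mxE.
Qed.

Lemma M_setZ t Mc : M_set phi x Mc -> M_set phi x (t *: Mc.1, t *: Mc.2).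
Proof.
move=> [symM MH]; split=> /=.
  by apply/symmetricmxP; rewrite linearZ /= -(symmetricmxP _ symM).
move=> g g0 xg0; transitivity (t * (\sum_(ij in basis_pairs x g) Mc.1 ij.1 ij.2 +
  \sum_(p < q | g \subset vars (phi p))
    (-1) ^+ #|g :&: pos_vars (phi p)| * Mc.2 p 0)); last by rewrite MH // mulr0.
rewrite mulrDr; congr (_ + _); rewrite mulr_sumr; apply: eq_bigr => i _; rewrite mxE //.
by rewrite mulrCA.
Qed.

Lemma M_set0 : M_set phi x (0 : 'M[R]_m, 0 : 'cV[R]_q).
Proof.
split=> /= [|g _ _]; first by apply/symmetricmxP; rewrite trmx0.
by rewrite !big1 ?addr0 // => i _; rewrite mxE ?mulr0.
Qed.

(** A nonzero value could be scaled, within [M_set], below any real bound. *)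
Lemma inner_inf_bounded S :
  (-oo < inner_inf phi x S)%E -> forall Mc, M_set phi x Mc -> inner_obj S Mc = 0.
Proof.
move=> bnd Mc MH; apply/eqP/negPn/negP => obj0.
have [r rlt] : exists r : R, (r%:E <= inner_inf phi x S)%E.
  case: (inner_inf phi x S) bnd => [r _|_|//]; first by exists r.
  (* If the infimum is +oo, any real is a lower bound. *)
  by exists 0; rewrite leey.
(* The scaled point has objective [r - 1], below the bound [r]. *)
pose t := (r - 1) / inner_obj S Mc.
have : (inner_inf phi x S <= (inner_obj S (t *: Mc.1, t *: Mc.2))%:E)%E.
  apply: ereal_inf_lbound.
  by exists (t *: Mc.1, t *: Mc.2); [exact: M_setZ|].
move=> /(le_trans rlt); rewrite inner_objZ mulfVK // lee_fin.
by rewrite lerDl oppr_ge0 ler10.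
Qed.

Lemma inner_inf_eq0 S :
  (forall Mc, M_set phi x Mc -> inner_obj S Mc = 0) -> inner_inf phi x S = 0%E.
Proof.
move=> obj0; rewrite /inner_inf; have -> : [set (inner_prod (1%:M - S) Mc.1 +
   \sum_(p < q) Mc.2 p 0)%:E | Mc in M_set phi x]%classic = [set 0%E]%classic.
  apply/seteqP; split=> [_ [Mc MH <-]|_ ->] /=; first by congr (_%:E); exact: obj0.
  (* The origin keeps [M_set] nonempty; otherwise the infimum would be +oo. *)
  by exists (0, 0); [exact: M_set0|congr (_%:E); exact: obj0 M_set0].
exact: ereal_inf1.
Qed.

(** * Clause signs and grouping of the entries by symmetric difference *)

Lemma clause_sign (C : clause n) g : g \subset vars C ->
  (-1) ^+ #|g| * \prod_(i in g) lit_sign R C i = (-1) ^+ #|g :&: pos_vars C|.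
Proof.
move=> /fintype.subsetP gC; rewrite -!prodr_const -big_split /=.
rewrite [RHS](eq_bigl (fun i => (i \in g) && (i \in pos_vars C))); last first.
  by move=> i; rewrite inE.
(* Each [i] in [g] contributes minus its literal sign: -1 if positive, 1 if negative. *)
rewrite big_mkcondr; apply: eq_bigr => i /gC.
rewrite inE /lit_sign; case: ifP => //= _; first by rewrite mulr1.
by move=> ->; rewrite mulrNN mulr1.
Qed.

(** The coefficients become the signs of the constraints in [M_set], so the two can be matched. *)
Lemma v_sdpE S (C : clause n) :
  v_sdp x S C = 1 - 2 ^- #|vars C| *
    \sum_(g : {set 'I_n} | g \subset vars C)
      (-1) ^+ #|g :&: pos_vars C| * moment x S g.
Proof.
by congr (1 - _ * _); apply: eq_bigr => g /clause_sign ->.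
Qed.

Lemma sum_basis_pairs (F : 'I_m * 'I_m -> R) :
  \sum_ij F ij = \sum_(g : {set 'I_n}) \sum_(ij in basis_pairs x g) F ij.
Proof.
rewrite (partition_big (fun ij => symdiff (tnth x ij.1) (tnth x ij.2)) predT) //=.
by apply: eq_bigr => g _; apply: eq_bigl => ij; rewrite inE.
Qed.

(** As an inner product with a 0/1 matrix, the class sum can be evaluated on [delta_mx] by
    [inner_prod_delta]. *)
Lemma basis_pairs_sumE g (M : 'M[R]_m) : M \is symmetricmx ->
  \sum_(ij in basis_pairs x g) M ij.1 ij.2 =
  inner_prod (\matrix_(i, j) ((i, j) \in basis_pairs x g)%:R) M.
Proof.
move=> symM; rewrite inner_prodE // big_mkcond; apply: eq_bigr => -[i j] _ /=.
by rewrite mxE; case: ifP; rewrite ?mul1r ?mul0r.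
Qed.

(** * Test points of [M_set] *)

Lemma M_set_diag_delta a : M_set phi x (delta_mx a a, 0 : 'cV[R]_q).
Proof.
have sym : (delta_mx a a : 'M[R]_m) \is symmetricmx.
  by apply/symmetricmxP; rewrite trmx_delta.
split=> //= g /negPf g0 _.
rewrite [X in _ + X]big1 ?addr0 => [|p _]; last by rewrite mxE mulr0.
(* The pair [(a, a)] belongs to the class of the empty set, which [M_set] leaves unconstrained. *)
by rewrite basis_pairs_sumE // inner_prod_delta mxE inE /= symdiffvv eq_sym g0.
Qed.

Lemma M_set_delta a b a' b' :
  symdiff (tnth x a) (tnth x b) = symdiff (tnth x a') (tnth x b') ->
  M_set phi x (delta_mx a b + delta_mx b a - (delta_mx a' b' + delta_mx b' a'),
    0 : 'cV[R]_q).
Proof.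
move=> ab; have sym : (delta_mx a b + delta_mx b a -
    (delta_mx a' b' + delta_mx b' a') : 'M[R]_m) \is symmetricmx.
  by apply/symmetricmxP; rewrite [RHS]linearB; congr (_ - _);
     rewrite linearD /= !trmx_delta addrC.
split=> //= g _ _.
rewrite [X in _ + X]big1 ?addr0 => [|p _]; last by rewrite mxE mulr0.
rewrite basis_pairs_sumE // inner_prodBr !inner_prodDr !inner_prod_delta !mxE.
(* All four pairs lie in one class, so their signed contributions cancel in every class sum. *)
by rewrite !inE /= (symdiffC (tnth x b)) (symdiffC (tnth x b')) ab subrr.
Qed.

(* Spreading the clause contributions evenly over x^gamma extends every vector c
   to a point of [M_set], so that c is unconstrained there. *)
Definition lift_mx (c : 'cV[R]_q) : 'M[R]_m :=
  \matrix_(i, j) let g := symdiff (tnth x i) (tnth x j) in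
    - (\sum_(p < q | g \subset vars (phi p))
         (-1) ^+ #|g :&: pos_vars (phi p)| * c p 0) / #|basis_pairs x g|%:R.

Lemma M_set_lift c : M_set phi x (lift_mx c, c).
Proof.
split=> /= [|g _ xg0].
  by apply/symmetricmxP/matrixP => i j; rewrite !mxE symdiffC.
rewrite (eq_bigr (fun=> - (\sum_(p < q | g \subset vars (phi p))
    (-1) ^+ #|g :&: pos_vars (phi p)| * c p 0) / #|basis_pairs x g|%:R)); last first.
  by move=> ij; rewrite inE mxE => /eqP ->.
(* The summand is constant on the class, so its cardinality, nonzero by [xg0], cancels the
   divisor. *)
rewrite sumr_const -[X in X + _]mulr_natr mulfVK ?addNr //.
by rewrite pnatr_eq0 cards_eq0.
Qed.

(** * Boundedness of the inner infimum *)

Hypothesis x_uniq : uniq x.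

Lemma tnth_basis_inj : injective (tnth x).
Proof. exact/tuple_uniqP. Qed.

Lemma basis_pairs0 i j : ((i, j) \in basis_pairs x finset.set0) = (i == j).
Proof. by rewrite inE symdiff_eq0 (inj_eq tnth_basis_inj). Qed.

Lemma X_set_of_bounded S : S \is symmetricmx ->
  (-oo < inner_inf phi x S)%E -> X_set x S.
Proof.
move=> symS /inner_inf_bounded obj0.
have diagS i : S i i = 1.
  have := obj0 _ (M_set_diag_delta i); rewrite /inner_obj inner_prod_delta !mxE eqxx.
  by rewrite big1 ?addr0 => [/subr0_eq //|p _]; rewrite mxE.
split=> // i j i' j' eqd.
(* Monomials are distinct, so the two pairs are both diagonal or both off-diagonal. *)
have eqij : (i == j) = (i' == j') by rewrite -!basis_pairs0 !inE /= eqd.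
have [ij|nij] := eqVneq i j.
  by move: eqij; rewrite ij eqxx => /esym/eqP <-; rewrite !diagS.
have ni'j' : i' != j' by rewrite -eqij.
have := obj0 _ (M_set_delta eqd); rewrite /inner_obj big1 ?addr0 => [|p _];
  last by rewrite mxE.
rewrite inner_prodBr !inner_prodDr !inner_prod_delta !mxE.
(* Off the diagonal the identity vanishes; by symmetry the test gives -2 [S i j] + 2 [S i' j'] =
   0. *)
rewrite [j == i]eq_sym [j' == i']eq_sym (negPf nij) (negPf ni'j').
by rewrite (symmetricmx_entry j i symS) (symmetricmx_entry j' i' symS); lra.
Qed.

Hypothesis x_one : finset.set0 \in x.
Hypothesis x_clauses : forall (p : 'I_q) g,
  g \subset vars (phi p) -> basis_pairs x g != finset.set0.

Lemma moment0 S : X_set x S -> moment x S finset.set0 = 1.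
Proof.
move=> XS; have /tnthP[i _] := x_one; have [_ diagS _] := XS.
by rewrite (moment_eq XS (_ : (i, i) \in _)) ?diagS // basis_pairs0.
Qed.

Lemma inner_objE S Mc : X_set x S -> M_set phi x Mc ->
  inner_obj S Mc =
  \sum_(p < q) 2 ^+ #|vars (phi p)| * (1 - v_sdp x S (phi p)) * Mc.2 p 0.
Proof.
move=> XS [symM MH]; have [symS diagS _] := XS.
rewrite /inner_obj inner_prodE // sum_basis_pairs (bigD1 finset.set0) //=.
(* The empty class is the diagonal, where [1%:M - S] is zero. *)
rewrite big1 => [|[i j]]; last first.
  by rewrite basis_pairs0 => /eqP -> /=; rewrite !mxE diagS eqxx subrr mul0r.
rewrite add0r.
(* On any other class [1%:M - S] is constantly [- moment x S g], and the constraint turns the class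
   sum of [Mc.1] into clause terms. *)
rewrite (eq_bigr (fun g => \sum_(p < q | g \subset vars (phi p))
   (-1) ^+ #|g :&: pos_vars (phi p)| * Mc.2 p 0 * moment x S g)); last first.
  move=> g g0; rewrite (eq_bigr (fun ij => - moment x S g * Mc.1 ij.1 ij.2)).
    rewrite -mulr_sumr -mulr_suml.
    (* For an empty class no clause contains [g], so both sides vanish and the default value of
       [moment] is harmless. *)
    have [xg0|xg0] := eqVneq (basis_pairs x g) finset.set0.
      rewrite xg0 big_set0 mulr0 big_pred0 ?mul0r // => p.
      by apply/negP => /x_clauses; rewrite xg0 eqxx.
    by have /eqP := MH g g0 xg0; rewrite addr_eq0 => /eqP ->; rewrite mulrNN mulrC.
  move=> [i j] ijg; rewrite (moment_eq XS ijg) /= !mxE.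
  have /negPf -> : i != j.
    by rewrite -basis_pairs0; move: ijg; rewrite !inE /= => /eqP ->.
  by rewrite sub0r.
rewrite (exchange_big_dep predT) //= -big_split /=; apply: eq_bigr => p _.
rewrite v_sdpE subKr mulVKf ?expf_neq0 ?pnatr_eq0 //.
(* The term of the empty set, where the moment is 1, accounts for the linear term in [Mc.2]. *)
rewrite [X in _ = X * _](bigD1 finset.set0) ?finset.sub0set //=.
rewrite moment0 // finset.set0I cards0 expr0 mulr1 mulrDl mul1r mulr_suml addrC.
congr (_ + _); apply: eq_big => [g|g _]; first by rewrite andbC.
by rewrite mulrAC.
Qed.

Lemma inner_obj_eq0P S : X_set x S ->
  (forall Mc, M_set phi x Mc -> inner_obj S Mc = 0) <->
  forall p, v_sdp x S (phi p) = 1.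
Proof.
move=> XS; split=> [obj0 p|v1 Mc MH]; last first.
  by rewrite inner_objE // big1 // => p _; rewrite v1 subrr mulr0 mul0r.
(* Lifting the unit vector at [p] isolates the coefficient of clause [p], a power of 2 times
   [1 - v_sdp x S (phi p)]. *)
have := obj0 _ (M_set_lift (delta_mx p 0)); rewrite inner_objE //;
  last exact: M_set_lift.
rewrite (bigD1 p) //= big1 => [|r /negPf rp]; last by rewrite mxE rp mulr0.
rewrite mxE !eqxx mulr1 addr0 => /eqP; rewrite mulf_eq0 expf_eq0 pnatr_eq0 andbF /=.
by rewrite subr_eq0 => /eqP.
Qed.

Lemma inner_inf_boundedP S : X_set x S ->
  (-oo < inner_inf phi x S)%E <-> forall p, v_sdp x S (phi p) = 1.
Proof.
move=> XS; rewrite -(inner_obj_eq0P XS); split; first exact: inner_inf_bounded.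
by move/inner_inf_eq0 ->; rewrite ltNyr.
Qed.

End Programmes.

Theorem mainTheorem7 (R : realType) (n m q : nat)
    (phi : 'I_q -> clause n) (x : m.-tuple {set 'I_n})
    (x_uniq : uniq x)
    (x_one : finset.set0 \in x)
    (x_clauses : forall (p : 'I_q) (g : {set 'I_n}),
       g \subset vars (phi p) -> basis_pairs x g != finset.set0) :
  [/\ max_equiv (lagrangian_dual (sos_prog R phi x)) (dual_prog R phi x),
      forall S : 'M[R]_m, X_set x S -> psd S ->
        ((-oo < inner_inf phi x S)%E <-> forall p, v_sdp x S (phi p) = 1) /\
        ((-oo < inner_inf phi x S)%E -> inner_inf phi x S = 0%E) &
      max_equiv (dual_prog R phi x) (feasibility_prog R phi x)].
Proof.
have inf0 S : (-oo < inner_inf phi x S)%E -> inner_inf phi x S = 0%E.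
  by move/inner_inf_bounded/inner_inf_eq0.
have objE S : max_obj (lagrangian_dual (sos_prog R phi x)) S = inner_inf phi x S.
  by congr ereal_inf; apply: eq_imagel => Mc _; rewrite lagrangianE.
split.
(* Membership in [X_set] is an implicit constraint of the Lagrangian dual: finiteness of its
   objective forces it. *)
- apply: max_equiv_effective => [|S _]; last exact: objE.
  apply/seteqP; split=> S [].
    move=> psdS; rewrite objE => bnd; split=> //; split=> //.
    by apply: X_set_of_bounded bnd => //; case: psdS.
  by move=> [_ psdS] bnd; split; rewrite ?objE.
- by move=> S XS _; split; [exact: inner_inf_boundedP|exact: inf0].
(* Here finiteness amounts to the clause equations, and the objective is then 0. *)
- apply: max_equiv_effective => [|S [_ bnd]]; last exact: inf0.
  apply/seteqP; split=> S [/=].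
    by move=> [XS psdS] bnd; split; [split=> //; exact/inner_inf_boundedP|exact: ltNyr].
  by move=> [XS psdS v1] _; split=> //=; exact/inner_inf_boundedP.
Qed.
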